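(* Let $\mathcal{F}$ be a pointwise almost periodic decomposition of a compact metrizable space $X$, and let $\hat{\mathcal{F}}$ be the decomposition of $X$ into closures of elements of $\mathcal{F}$. Then the following are equivalent: (1) $\mathcal{F}$ is $R$-closed; (2) $\hat{\mathcal{F}}$ is upper semicontinuous (usc); (3) the quotient space $X/\hat{\mathcal{F}}$ is Hausdorff.
   Context: A decomposition of a set $X$ is a family $\mathcal{F}$ of pairwise disjoint nonempty subsets of $X$ whose union is $X$. For $x\in X$, $L_x$ denotes the element of $\mathcal{F}$ containing $x$. A subset $A\subseteq X$ is saturated (with respect to $\mathcal{F}$) if $A=\bigcup_{x\in A}L_x$. Let $X$ be a topological space. The decomposition $\mathcal{F}$ is upper semicontinuous (usc) if each element of $\mathcal{F}$ is both closed and compact and, for every $L\in\mathcal{F}$ and every open neighbourhood $U$ of $L$, there is a saturated neighbourhood of $L$ contained in $U$. $\mathcal{F}$ is $R$-closed if $R:=\{(x,y)\in X\times X \mid y\in\overline{L_x}\}$ is closed in $X\times X$. $\mathcal{F}$ is pointwise almost periodic if the set of all closures of elements of $\mathcal{F}$ is also a decomposition of $X$; this decomposition is then denoted $\hat{\mathcal{F}}$, and $X/\hat{\mathcal{F}}$ carries the quotient topology. *)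

(* Defs.v *)
From HB Require Import structures.
From mathcomp Require Import all_boot all_order all_algebra.
From mathcomp Require Import generic_quotient.
From mathcomp Require Import all_classical all_reals all_analysis.
Set Implicit Arguments.
Unset Strict Implicit.
Unset Printing Implicit Defensive.
Import Order.TTheory GRing.Theory Num.Theory.
Local Open Scope classical_set_scope.
Local Open Scope ring_scope.
Local Open Scope quotient_scope.

Definition is_metric (R : realType) (X : Type) (d : X -> X -> R) : Prop :=
  [/\ forall x y, 0 <= d x y,
      forall x y, d x y = 0 <-> x = y,
      forall x y, d x y = d y x
    & forall x y z, d x z <= d x y + d y z].

Definition metrizable (R : realType) (X : topologicalType) : Prop :=
  exists2 d : X -> X -> R, is_metric d &
    forall x : X, nbhs x = nbhs_ball_ (fun x e => [set y | d x y < e]) x.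

Definition decomposition (X : Type) (F : set (set X)) : Prop :=
  partition F id [set: X].

(* [pblock] selects a member of [F] containing [x]; it is unique, and exists,
   when [F] is a decomposition. *)
Definition leaf (X : Type) (F : set (set X)) (x : X) : set X := pblock F id x.

Definition saturated (X : Type) (F : set (set X)) (A : set X) : Prop :=
  A = \bigcup_(x in A) leaf F x.

Definition usc (X : topologicalType) (F : set (set X)) : Prop :=
  (forall L, F L -> closed L /\ compact L) /\
  (forall L U, F L -> open U -> L `<=` U ->
     exists V, [/\ saturated F V, set_nbhs L V & V `<=` U]).

Definition R_closed (X : topologicalType) (F : set (set X)) : Prop :=
  closed [set xy : X * X | closure (leaf F xy.1) xy.2].

Definition leaf_closures (X : topologicalType) (F : set (set X)) :
  set (set X) := [set closure L | L in F].

Definition pointwise_almost_periodic (X : topologicalType) (F : set (set X)) :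
  Prop := decomposition (leaf_closures F).

Definition same_leaf (X : Type) (F : set (set X)) : rel X :=
  fun x y => `[< leaf F x = leaf F y >].

Lemma same_leaf_refl (X : Type) (F : set (set X)) : reflexive (same_leaf F).
Proof. by move=> x; apply/asboolP. Qed.

Lemma same_leaf_sym (X : Type) (F : set (set X)) : symmetric (same_leaf F).
Proof. by move=> x y; apply: asbool_equiv_eq; split=> ->. Qed.

Lemma same_leaf_trans (X : Type) (F : set (set X)) : transitive (same_leaf F).
Proof. by move=> y x z /asboolP xy /asboolP yz; apply/asboolP; rewrite xy. Qed.

Definition same_leaf_equiv (X : choiceType) (F : set (set X)) : equiv_rel X :=
  EquivRel (same_leaf F) (same_leaf_refl F) (same_leaf_sym F)
    (@same_leaf_trans X F).

(* The quotient space X/F: the points are the classes of [same_leaf F], which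
   are the members of [F] when [F] is a decomposition. *)
Definition leaf_space (X : topologicalType) (F : set (set X)) :
  topologicalType := quotient_topology {eq_quot same_leaf_equiv F}.

(* Main.v *)
(** Write [L x] for the member of the closure decomposition through [x]: it is
the closure of the leaf of [x], so [R] is the equivalence relation whose classes
are the sets [L x].  If [R] is closed, then by the tube lemma
[{z | L z `<=` U}] is open for every open [U], which is upper semicontinuity.
Conversely upper semicontinuity makes all these sets open.  They are saturated,
so if normality provides disjoint open sets [U] and [V] around two distinct
classes, then [{z | L z `<=` U}] and [{z | L z `<=` V}] separate the two points
of the quotient.  If the
quotient is Hausdorff, [R] is closed as the preimage of the diagonal. *)
Require Import Defs.
From mathcomp Require Import all_boot all_order all_algebra.
From mathcomp Require Import generic_quotient.
From mathcomp Require Import all_classical all_reals all_analysis.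
Set Implicit Arguments.
Unset Strict Implicit.
Unset Printing Implicit Defensive.
Import Order.TTheory GRing.Theory Num.Theory.
Local Open Scope classical_set_scope.

Section Decomposition.
Context {X : Type} {F : set (set X)}.
Hypothesis F_decomposition : decomposition F.

Lemma leafP (x : X) : F (leaf F x) /\ leaf F x x.
Proof.
have [cov _ _] := F_decomposition.
have [L FL Lx] : cover F id x by rewrite cov.
(* [pblock_index] chooses with [get]; the member [L] through [x] rules out its default value. *)
by rewrite /leaf /pblock /pblock_index; apply: (@getPex _ [set K | F K /\ K x]);
  exists L.
Qed.

Lemma leaf_eq (L : set X) (x : X) : F L -> L x -> leaf F x = L.
Proof.
move=> FL Lx; have [_ triv _] := F_decomposition.
have [Fx xx] := leafP x.
by apply: (triv _ _ Fx FL); exists x.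
Qed.

Lemma leaf_eqP (x y : X) : leaf F x = leaf F y <-> leaf F x y.
Proof.
split=> [->|xy]; first by have [] := leafP y.
by rewrite (leaf_eq (leafP x).1 xy).
Qed.

Lemma saturatedP (A : set X) :
  saturated F A <-> forall x, A x -> leaf F x `<=` A.
Proof.
split=> [-> x [a Aa ax] y|sat].
  by rewrite -((leaf_eqP a x).2 ax) => ay; exists a.
apply/seteqP; split=> [x Ax|y [x Ax]]; last exact: sat.
by exists x => //; have [] := leafP x.
Qed.

Lemma leaf_disjoint (x y : X) :
  leaf F x <> leaf F y -> leaf F x `&` leaf F y = set0.
Proof.
move=> xy; apply/seteqP; split=> // z [/leaf_eqP xz /leaf_eqP yz].
by apply: xy; rewrite xz yz.
Qed.

End Decomposition.

(** When [F] is a decomposition, this is the largest saturated subset of [U]. *)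
Definition leaf_core {X : Type} (F : set (set X)) (U : set X) : set X :=
  [set z | leaf F z `<=` U].

Lemma leaf_core_saturated {X : Type} {F : set (set X)} (U : set X) :
  decomposition F -> saturated F (leaf_core F U).
Proof.
move=> dF; apply/saturatedP => // x xU y /leaf_eqP xy.
by rewrite /leaf_core /= -xy.
Qed.

Lemma leaf_leaf_closures {X : topologicalType} {F : set (set X)} (x : X) :
  decomposition F -> pointwise_almost_periodic F ->
  leaf (leaf_closures F) x = closure (leaf F x).
Proof.
move=> dF pF; have [Fx xx] := leafP dF x.
by apply: leaf_eq => //; [exists (leaf F x)|exact: subset_closure].
Qed.

(** A saturated neighbourhood [V] of the leaf of [z] inside [U] contains the whole leaf of each of
    its points, so it lies in the core; hence the core is a neighbourhood of [z]. *)
Lemma leaf_core_open {X : topologicalType} {F : set (set X)} (U : set X) :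
  decomposition F -> usc F -> open U -> open (leaf_core F U).
Proof.
move=> dF [_ uscF] oU; rewrite openE => z zU.
have [V [satV nV VU]] := uscF _ _ (leafP dF z).1 oU zU.
apply: filterS (nV z (leafP dF z).2) => w Vw.
exact: subset_trans ((saturatedP dF V).1 satV w Vw) VU.
Qed.

(** For [z] in this set, each [y] lies in [U] or is unrelated to [z]. Both conditions are open, so
    one of them persists near [(z, y)], and compactness makes the neighbourhood of [z] uniform in
    [y]. *)
Lemma closed_relation_core_open {X : topologicalType} (r : X -> set X)
    (U : set X) : compact [set: X] -> closed [set xy : X * X | r xy.1 xy.2] ->
  open U -> open [set z | r z `<=` U].
Proof.
move=> cX /closed_openC; rewrite openE => clr oU; rewrite openE => z zU.
have : \forall z' \near z, [set: X] `<=` (fun y => r z' y -> U y).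
  apply: (compact_near_coveringP _).1 cX _ _ _ _ _ => y _.
  have [Uy|nUy] := pselect (U y).
    exists (U, setT); first by split; [exact: open_nbhs_nbhs|exact: filterT].
    by case=> y' z' [].
  have [|[A B] [zA yB] AB] := clr (z, y); first by move=> /zU.
  (* The factors are swapped: the near-covering puts the compact variable first, the relation puts
     it second. *)
  exists (B, A) => // -[y' z'] [By' Az'] /= r'.
  by case: (AB (z', y')).
by apply: filterS => z' sub y; exact: sub.
Qed.

Lemma R_closed_usc {X : topologicalType} {F : set (set X)} :
  decomposition F -> pointwise_almost_periodic F -> compact [set: X] ->
  R_closed F -> usc (leaf_closures F).
Proof.
move=> dF pF cX RF; split=> [_ [L FL <-]|L U GL oU LU].
  split; first exact: closed_closure.
  by apply: (subclosed_compact _ cX) => //; exact: closed_closure.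
exists (leaf_core (leaf_closures F) U); split.
- exact: leaf_core_saturated.
- move=> z Lz; apply: open_nbhs_nbhs; split; last first.
    by rewrite /leaf_core /= (leaf_eq pF GL Lz).
  (* Rewriting the classes as closures of leaves of [F] exposes the relation that [R_closed] assumes
     closed. *)
  rewrite (_ : leaf_core _ U = [set z | closure (leaf F z) `<=` U]).
    exact: (closed_relation_core_open (r := fun z => closure (leaf F z))).
  by apply/seteqP; split=> w; rewrite /leaf_core /= leaf_leaf_closures.
- by move=> z; apply; have [] := leafP pF z.
Qed.

Section LeafSpace.
Local Open Scope quotient_scope.
Context {X : topologicalType} {F : set (set X)}.

Lemma pi_leaf_spaceP (x y : X) :
  \pi_(leaf_space F) x = \pi_(leaf_space F) y <-> leaf F x = leaf F y.
Proof.
split=> [/eqquotP/asboolP //|xy].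
by apply/eqquotP/asboolP.
Qed.

Lemma leaf_repr_pi (x : X) : leaf F (repr (\pi_(leaf_space F) x)) = leaf F x.
Proof. by apply/pi_leaf_spaceP; rewrite reprK. Qed.

Lemma usc_leaf_space_hausdorff (R : realType) :
  normal_space X -> decomposition F -> usc F -> hausdorff_space (leaf_space F).
Proof.
move=> nX dF uF; rewrite open_hausdorff => p q /eqP pq.
have disj : leaf F (repr p) `&` leaf F (repr q) = set0.
  apply: leaf_disjoint => // /pi_leaf_spaceP.
  by rewrite !reprK.
have clL x : closed (leaf F x) by have [] := uF.1 _ (leafP dF x).1.
have [U [V [oU oV pU qV UV]]] :=
  (normal_openP (R := R)).1 nX _ _ (clL _) (clL _) disj.
(* The core is saturated, so testing one representative decides membership for the whole class; the
   preimage of [push W] under the projection is then the core of [W]. *)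
pose push W : set (leaf_space F) := [set z | leaf_core F W (repr z)].
have push_open W : open W -> open (push W).
  move=> oW; suff : open (\pi_(leaf_space F) @^-1` push W) by [].
  rewrite (_ : _ @^-1` _ = leaf_core F W); first exact: leaf_core_open.
  by apply/seteqP; split=> z; rewrite /push /leaf_core /= leaf_repr_pi.
exists (push U, push V) => /=; first by rewrite !inE.
split; [exact: push_open|exact: push_open|].
apply/eqP/seteqP; split=> // z [zU zV].
have [_ zz] := leafP dF (repr z).
suff : (U `&` V) (repr z) by rewrite UV.
by split; [exact: zU|exact: zV].
Qed.

Lemma hausdorff_same_leaf_closed :
  hausdorff_space (leaf_space F) ->
  closed [set xy : X * X | leaf F xy.1 = leaf F xy.2].
Proof.
move=> hF [x y] clxy; apply/pi_leaf_spaceP/hF => A B nA nB.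
have nAB : nbhs (x, y)
    ((\pi_(leaf_space F) @^-1` A) `*` (\pi_(leaf_space F) @^-1` B)).
  exists (\pi_(leaf_space F) @^-1` A, \pi_(leaf_space F) @^-1` B) => //.
  by split; exact: pi_continuous.
(* The product of the two preimages contains a pair of points with the same leaf; their common image
   lies in both [A] and [B]. *)
have [[a b] [/= /pi_leaf_spaceP ab [Aa Bb]]] := clxy _ nAB.
by exists (\pi_(leaf_space F) a); split=> //; rewrite ab.
Qed.

End LeafSpace.

(** The closures of leaves partition [X], so lying in the closure of the leaf of [x] amounts to
    having the same class as [x]. This presents [R] as the kernel of the quotient map. *)
Lemma R_closedE {X : topologicalType} (F : set (set X)) :
  decomposition F -> pointwise_almost_periodic F ->
  R_closed F = closed [set xy : X * X |
    leaf (leaf_closures F) xy.1 = leaf (leaf_closures F) xy.2].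
Proof.
move=> dF pF; congr closed; apply/seteqP; split=> -[x y] /=.
  by rewrite -leaf_leaf_closures// => /(leaf_eqP pF).
by move=> /(leaf_eqP pF); rewrite leaf_leaf_closures.
Qed.

(** By the triangle inequality, balls of radius half the distance between two distinct points are
    disjoint. With compactness this yields the normality used for the quotient. *)
Lemma metrizable_hausdorff (R : realType) (X : topologicalType) :
  metrizable R X -> hausdorff_space X.
Proof.
move=> [d [d_ge0 d_eq0 d_sym d_tri] nbhsE] p q cpq.
apply/d_eq0/eqP; rewrite eq_le d_ge0 andbT leNgt; apply/negP => dpq.
have d2 : (0 < d p q / 2)%R by rewrite divr_gt0.
have nball x : nbhs x [set y | (d x y < d p q / 2)%R].
  by rewrite nbhsE; exists (d p q / 2)%R.
have [z [/= pz qz]] := cpq _ _ (nball p) (nball q).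
have := le_lt_trans (d_tri p z q) (ltrD pz _).
by rewrite (d_sym z q) => /(_ _ qz); rewrite -splitr ltxx.
Qed.

Theorem proposition2p2 (R : realType) (X : topologicalType)
    (F : set (set X))
    (X_metrizable : metrizable R X) (X_compact : compact [set: X])
    (F_decomposition : decomposition F)
    (F_pap : pointwise_almost_periodic F) :
  (R_closed F <-> usc (leaf_closures F)) /\
  (usc (leaf_closures F) <-> hausdorff_space (leaf_space (leaf_closures F))).
Proof.
have R_usc : R_closed F -> usc (leaf_closures F) by exact: R_closed_usc.
have usc_h : usc (leaf_closures F) ->
    hausdorff_space (leaf_space (leaf_closures F)).
  apply: (usc_leaf_space_hausdorff R) => //.
  by apply: compact_normal => //; exact: metrizable_hausdorff X_metrizable.
have h_R : hausdorff_space (leaf_space (leaf_closures F)) -> R_closed F.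
  by rewrite R_closedE//; exact: hausdorff_same_leaf_closed.
split; split; [exact: R_usc|by move=> /usc_h /h_R|exact: usc_h|].
by move=> /h_R /R_usc.
Qed.
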